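(* For all integers $\omega,\epsilon,p_1,p_2,n\ge 0$ there is a bijection $$\rho:\mathcal{U}(\omega,\epsilon,p_1,p_2,n)\to\mathcal{L}(\omega,\epsilon,p_1,p_2,n-2(\omega+2\epsilon)).$$ Moreover, $\rho$ sends each upper minimal segment with quadruple $(W,\omega,\epsilon,s)$ to a lower minimal segment with quadruple $(W,\omega,\epsilon,s-3)$.
   Context: A Schur partition is a partition of an integer into positive parts such that consecutive parts differ by at least $3$, and no two consecutive parts differing by exactly $3$ are both multiples of $3$. Upper pairs: in a Schur partition $\pi$, a part $x$ is in an upper pair if $x+3$ or $x-3$ is also a part, except when (i) $x$ is odd and is the largest element of an odd-length maximal arithmetic progression of parts of $\pi$ with common difference $3$, or (ii) $x$ is even and is the smallest element of such an odd-length maximal progression. A part not in an upper pair is an upper singleton. Lower pairs: a part $x>1$ is in a lower pair if $x+3$ or $x-3$ is also a part, except when (i) $x$ is even and is the largest element of an odd-length maximal arithmetic progression with common difference $3$ of parts greater than $1$, or (ii) $x$ is odd and is the smallest element of such a progression. A part not in a lower pair (including the part $1$) is a lower singleton. A primitive upper minimal segment is a Schur partition of one of the forms: (1) $o,o+4,\dots,o+4x,\ o+4x+5,o+4x+9,\dots,o+4(x+y)+5$ with $o>3$ odd and $x,y\ge0$; (2) $o,o+4,\dots,o+4x,\ p^*+3,p^*+6,\dots,p^*+3p,\ p^*+3p+4,\dots,p^*+3p+4y$, where $p^*=o+4x+1\not\equiv0\pmod 3$, $o>3$ odd, $x\ge0$, $y\ge1$, and $p\ge2$ even. Let $\mathcal{U}$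 be the smallest set of Schur partitions containing all primitive upper minimal segments and closed under: (Suffix rule) if $\Sigma\in\mathcal{U}$ has largest part $e$ even with $e\not\equiv0\pmod3$, then $\Sigma$ together with the parts $e+3,e+6,\dots,e+3p,\ e+3p+4,\dots,e+3p+4y$ ($p\ge2$ even, $y\ge1$) is in $\mathcal{U}$; (Prefix rule) if $\Sigma\in\mathcal{U}$ has smallest part $o=o'+4k+3(p+1)+1\not\equiv 0\pmod 3$ with $o'>3$ odd, $k\ge0$, $p\ge2$ even, then $\Sigma$ together with the parts $o',o'+4,\dots,o'+4k,\ o'+4k+4,o'+4k+7,\dots,o'+4k+3p+1$ is in $\mathcal{U}$. An upper minimal segment (here, as a partition in its own right) is an element of $\mathcal{U}$. Let $h$ subtract $3$ from every part. A lower minimal segment is a partition of the form $h(\Sigma)$ with $\Sigma\in\mathcal{U}$ whose smallest and largest parts are lower singletons. The S-codeword of an upper (resp. lower) minimal segment is the word obtained by listing its parts in increasing order and writing $S$ for each upper (resp. lower) singleton and $P$ for each part in an upper (resp. lower) pair. Its quadruple is $(W,\omega,\epsilon,s)$ where $W$ is the S-codeword, $\omega$ the number of odd parts, $\epsilon$ the number of even parts, and $s$ the smallest part. $\mathcal{U}(\omega,\epsilon,p_1,p_2,n)$ is the set of upper minimal segments with sum of parts $n$, $\omega$ odd parts, $\epsilon$ even parts, $p_1$ parts that are in upper pairs and are $\equiv1\pmod3$, and $p_2$ parts that are in upper pairs and are $\equiv 2\pmod 3$. $\mathcal{L}(\omega,\epsilon,p_1,p_2,n)$ is defined analogously for lower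 minimal segments with lower pairs. *)

(* Defs.v *)
From mathcomp Require Import all_boot ssralg ssrint zify.
From mathcomp Require Import classical_sets functions.
Set Implicit Arguments.
Unset Strict Implicit.
Unset Printing Implicit Defensive.

(* A partition is the sequence of its parts in increasing order; its smallest
   and largest parts are then [head 0 t] and [last 0 t]. *)

Definition schur_gap (x y : nat) : bool :=
  (x + 3 <= y) && ~~ [&& y == x + 3, 3 %| x & 3 %| y].

Definition schur (t : seq nat) : bool :=
  all (fun x => 0 < x) t && sorted schur_gap t.

(* The l terms a, a + d, ..., a + (l - 1) d. *)
Definition ap (d a l : nat) : seq nat := mkseq (fun i => a + d * i) l.

Definition max_ap3 (q : seq nat) (a l : nat) : bool :=
  [&& 0 < l, all (mem q) (ap 3 a l), a + 3 * l \notin q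
    & ~~ has (fun y => y + 3 == a) q].

(* A progression of elements of q has at most [size q] terms and starts in q,
   so the bounds on l and a below lose nothing. *)
Definition smallest_of_odd_ap3 (q : seq nat) (x : nat) : bool :=
  has (fun l => odd l && max_ap3 q x l) (iota 1 (size q)).

Definition largest_of_odd_ap3 (q : seq nat) (x : nat) : bool :=
  has (fun l => odd l && has (fun a => max_ap3 q a l && (x == a + 3 * l.-1)) q)
      (iota 1 (size q)).

Definition has_neighbor3 (t : seq nat) (x : nat) : bool :=
  has (fun y => (y == x + 3) || (y + 3 == x)) t.

Definition in_upper_pair (t : seq nat) (x : nat) : bool :=
  [&& has_neighbor3 t x,
      ~~ (odd x && largest_of_odd_ap3 t x)
    & ~~ (~~ odd x && smallest_of_odd_ap3 t x)].

Definition in_lower_pair (t : seq nat) (x : nat) : bool :=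
  let q := [seq y <- t | 1 < y] in
  [&& 1 < x, has_neighbor3 t x,
      ~~ (~~ odd x && largest_of_odd_ap3 q x)
    & ~~ (odd x && smallest_of_odd_ap3 q x)].

Definition primitive_form1 (o x y : nat) : seq nat :=
  ap 4 o x.+1 ++ ap 4 (o + 4 * x + 5) y.+1.

Definition primitive_form2 (o x p y : nat) : seq nat :=
  let ps := o + 4 * x + 1 in
  ap 4 o x.+1 ++ ap 3 (ps + 3) p ++ ap 4 (ps + 3 * p + 4) y.

Inductive primitive_upper_minimal (t : seq nat) : Prop :=
| Primitive1 (o x y : nat) of
    odd o & 3 < o & t = primitive_form1 o x y & schur t
| Primitive2 (o x p y : nat) of
    odd o & 3 < o & ~~ (3 %| o + 4 * x + 1) & 1 <= y & 2 <= p & ~~ odd p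
    & t = primitive_form2 o x p y & schur t.

Definition suffix_parts (e p y : nat) : seq nat :=
  ap 3 (e + 3) p ++ ap 4 (e + 3 * p + 4) y.

Definition prefix_parts (o k p : nat) : seq nat :=
  ap 4 o k.+1 ++ ap 3 (o + 4 * k + 4) p.

(* Both closure rules produce Schur partitions: see [upper_minimal_schur]. *)
Inductive upper_minimal : seq nat -> Prop :=
| UpperPrimitive (t : seq nat) :
    primitive_upper_minimal t -> upper_minimal t
| UpperSuffix (t : seq nat) (p y : nat) :
    upper_minimal t ->
    ~~ odd (last 0 t) -> ~~ (3 %| last 0 t) ->
    2 <= p -> ~~ odd p -> 1 <= y ->
    upper_minimal (t ++ suffix_parts (last 0 t) p y)
| UpperPrefix (t : seq nat) (o k p : nat) :
    upper_minimal t ->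
    head 0 t = o + 4 * k + 3 * (p + 1) + 1 -> ~~ (3 %| head 0 t) ->
    odd o -> 3 < o -> 2 <= p -> ~~ odd p ->
    upper_minimal (prefix_parts o k p ++ t).

(* Only applied to members of [upper_minimal], whose parts all exceed 3 (see
   [upper_minimal_gt3]), so the truncated subtraction is the true one. *)
Definition shift3 (t : seq nat) : seq nat := [seq x - 3 | x <- t].

Definition lower_minimal (t : seq nat) : Prop :=
  exists2 u, upper_minimal u &
    [/\ t = shift3 u, ~~ in_lower_pair t (head 0 t)
      & ~~ in_lower_pair t (last 0 t)].

Inductive letter : Set := LetterS | LetterP.

(* The statistics below take the pair predicate ([in_upper_pair] or
   [in_lower_pair]) as a parameter. *)
Section Statistics.
Variable in_pair : seq nat -> nat -> bool.

Definition codeword (t : seq nat) : seq letter :=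
  [seq if in_pair t x then LetterP else LetterS | x <- t].

Definition nb_odd (t : seq nat) : nat := count odd t.

Definition nb_even (t : seq nat) : nat := count (fun x => ~~ odd x) t.

Definition quadruple (t : seq nat) : seq letter * nat * nat * int :=
  (codeword t, nb_odd t, nb_even t, Posz (head 0 t)).

Definition nb_pair_mod3 (r : nat) (t : seq nat) : nat :=
  count (fun x => in_pair t x && (x %% 3 == r)) t.

(* n is an integer because the sum n - 2 (w + 2 e) may be negative. *)
Definition segments (minimal : seq nat -> Prop) (w e p1 p2 : nat) (n : int) :
    set (seq nat) :=
  fun t => minimal t /\
    [/\ Posz (sumn t) = n, nb_odd t = w, nb_even t = e,
        nb_pair_mod3 1 t = p1 & nb_pair_mod3 2 t = p2].

End Statistics.

Definition upper_quadruple := quadruple in_upper_pair.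
Definition lower_quadruple := quadruple in_lower_pair.
Definition upper_segments := segments in_upper_pair upper_minimal.
Definition lower_segments := segments in_lower_pair lower_minimal.

Lemma ap_cons d a l : ap d a l.+1 = a :: ap d (a + d) l.
Proof.
rewrite /ap /mkseq /= muln0 addn0 -[1]/(1 + 0) iotaDl -map_comp.
by congr cons; apply: eq_map => i /=; lia.
Qed.

Lemma ap_gt3 d a l : 3 < a -> all (fun x => 3 < x) (ap d a l).
Proof. by move=> a3; rewrite all_map; apply/allP => i _ /=; lia. Qed.

Lemma schur_path_ap3 a p s : ~~ (3 %| a) ->
  path schur_gap a (ap 3 (a + 3) p ++ s) = path schur_gap (a + 3 * p) s.
Proof.
elim: p a => [|p IH] a na; first by rewrite muln0 addn0.
rewrite ap_cons /= IH; last by lia.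
have -> : schur_gap a (a + 3) by rewrite /schur_gap; lia.
by congr path; lia.
Qed.

Lemma schur_path_ap4 a y s :
  path schur_gap a (ap 4 (a + 4) y ++ s) = path schur_gap (a + 4 * y) s.
Proof.
elim: y a => [|y IH] a; first by rewrite muln0 addn0.
rewrite ap_cons /= IH.
have -> : schur_gap a (a + 4) by rewrite /schur_gap; lia.
by congr path; lia.
Qed.

Lemma upper_minimal_inv t : upper_minimal t ->
  [/\ t != [::], all (fun x => 3 < x) t & sorted schur_gap t].
Proof.
elim=> {t} [t []|t p y _ [tn t3 St] _ n3 _ _ _|t o k p _ [tn t3 St] ho n3 _ o3 _ _].
- move=> o x y _ o3 -> /andP[_ St]; split=> //.
  by rewrite /primitive_form1 all_cat !ap_gt3 //; lia.
- move=> o x p y _ o3 _ _ _ _ -> /andP[_ St]; split=> //.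
  by rewrite /primitive_form2 !all_cat !ap_gt3 //; lia.
- case: t tn t3 St n3 => [//|a t] _ t3 St n3; split=> //.
    have l3 : 3 < last a t := allP t3 _ (mem_last a t).
    rewrite all_cat t3 /suffix_parts /=.
    by rewrite all_cat !ap_gt3 //; lia.
  rewrite /= cat_path; apply/andP; split=> //.
  by rewrite /suffix_parts /= schur_path_ap3 // -[ap 4 _ _]cats0 schur_path_ap4.
- case: t tn t3 St ho n3 => [//|a t] _ t3 St; rewrite [head 0 _]/= => ho n3.
  split=> //.
    rewrite all_cat; apply/andP; split=> //.
    by rewrite /prefix_parts all_cat !ap_gt3 //; lia.
  rewrite /= in St.
  rewrite /prefix_parts ap_cons /= -catA schur_path_ap4.
  have -> : o + 4 * k + 4 = (o + 4 * k + 1) + 3 by lia.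
  case: p ho => [|p] ho; first by rewrite /= St andbT /schur_gap; lia.
  rewrite ap_cons /= schur_path_ap3; last by lia.
  by rewrite /= St andbT /schur_gap; lia.
Qed.

Lemma upper_minimal_gt3 t : upper_minimal t -> all (fun x => 3 < x) t.
Proof. by case/upper_minimal_inv. Qed.

Lemma upper_minimal_schur t : upper_minimal t -> schur t.
Proof.
case/upper_minimal_inv => _ t3 St; rewrite /schur St andbT.
by apply: sub_all t3 => x; lia.
Qed.

(* Main.v *)
(* An upper minimal segment alternates singletons with blocks of paired parts of
   even length. Once the smallest part, the block lengths and the number [a] of
   odd singletons are fixed, the segment is determined: the odd singletons come
   first, and making a singleton even raises it by 1 and moves no other part.
   The conditions modulo 3 do not involve [a], so [a] ranges over 1, ..., N - 1,
   where N is the number of singletons. The bijection replaces [a] by [N - a]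
   and then subtracts 3 from every part, which exchanges the parities. *)
Require Import Defs.
From mathcomp Require Import all_boot ssralg ssrint.
From mathcomp Require Import classical_sets functions.
From mathcomp Require Import zify.

Set Implicit Arguments.
Unset Strict Implicit.
Unset Printing Implicit Defensive.

(** * Segments described by block lengths *)

(* [t] is an odd base value of the first singleton, [bs] lists the lengths of
   the blocks of paired parts between consecutive singletons, and [a] is the
   number of odd singletons: these keep their base value, the later ones are
   raised by 1 and hence are even. *)
Fixpoint segment (t a : nat) (bs : seq nat) : seq nat :=
  t + (a == 0) ::
  (if bs is b :: bs' then ap 3 (t + 4) b ++ segment (t + 4 + 3 * b) a.-1 bs'
   else [::]).

Fixpoint pair_word (bs : seq nat) : seq bool :=
  false :: (if bs is b :: bs' then nseq b true ++ pair_word bs' else [::]).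

(** All parts of the block after base value [t] are congruent to [t + 1] modulo 3, so the Schur
    condition on gaps of 3 forbids that 3 divides [t + 1]. *)
Fixpoint blocks_mod3 (t : nat) (bs : seq nat) : bool :=
  if bs is b :: bs' then
    ((b == 0) || ~~ (3 %| t + 1)) && blocks_mod3 (t + 4 + 3 * b) bs'
  else true.

(** There are [size bs + 1] singletons; the bounds on [a] make the first odd and the last even. *)
Definition valid (s a : nat) (bs : seq nat) : bool :=
  [&& odd s, 3 < s, 0 < a <= size bs, all (fun b => ~~ odd b) bs
    & blocks_mod3 s bs].

(** * Membership in progressions and segments *)

Lemma mem_ap d a l x :
  reflect (exists2 i, i < l & x = a + d * i) (x \in ap d a l).
Proof.
apply: (iffP mapP) => [[i]|[i il ->]].
  by rewrite mem_iota => il ->; exists i.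
by exists i; rewrite ?mem_iota.
Qed.

Lemma ap_uniq d a l : 0 < d -> uniq (ap d a l).
Proof.
move=> d0; rewrite map_inj_uniq ?iota_uniq // => i j /= /addnI /eqP.
by rewrite eqn_pmul2l // => /eqP.
Qed.

Lemma size_ap d a l : size (ap d a l) = l.
Proof. exact: size_mkseq. Qed.

Lemma segment_ge t a bs y : y \in segment t a bs -> t <= y.
Proof.
elim: bs t a => [|b bs IH] t a /=; rewrite inE; first by move/eqP->; lia.
case/orP=> [/eqP ->|]; first lia.
by rewrite mem_cat => /orP[/mem_ap[i _ ->]|/IH]; lia.
Qed.

Lemma mem_segment_head t a bs : t + (a == 0) \in segment t a bs.
Proof. by case: bs => [|b bs] /=; rewrite inE ?eqxx. Qed.

Lemma mem_segment_cons t a b bs y :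
  y \in segment t a (b :: bs) =
  [|| y == t + (a == 0), y \in ap 3 (t + 4) b
    | y \in segment (t + 4 + 3 * b) a.-1 bs].
Proof. by rewrite /= inE mem_cat. Qed.

Lemma segment_notin t a bs y : y < t + 4 -> y != t + (a == 0) ->
  y \notin segment t a bs.
Proof.
move=> yt yn; apply/negP; case: bs => [|b bs].
  by rewrite /= inE (negPf yn).
rewrite mem_segment_cons (negPf yn) /= => /orP[/mem_ap[i _ yE]|/segment_ge]; lia.
Qed.

(** * Maximal progressions and paired parts *)

Lemma max_ap3P q a l :
  reflect [/\ 0 < l, {subset ap 3 a l <= q}, a + 3 * l \notin q
           & forall y, y \in q -> y + 3 != a] (max_ap3 q a l).
Proof.
apply: (iffP and4P) => -[l0 sq nq h]; split=> //.
- exact/allP.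
- by move=> y yq; apply: contra h => yE; apply/hasP; exists y.
- exact/allP.
- by apply/hasPn => y /h.
Qed.

Lemma max_ap3_size q a l : max_ap3 q a l -> l <= size q.
Proof.
case/max_ap3P=> _ sq _ _; rewrite -(size_ap 3 a l).
by apply: uniq_leq_size sq; apply: ap_uniq.
Qed.

Lemma smallest_of_odd_ap3P q x :
  reflect (exists2 l, odd l & max_ap3 q x l) (smallest_of_odd_ap3 q x).
Proof.
apply: (iffP hasP) => [[l _ /andP[]]|[l ol ml]]; first by exists l.
exists l; last by rewrite ol.
by rewrite mem_iota; have := max_ap3_size ml; case: l ol {ml}; lia.
Qed.

Lemma largest_of_odd_ap3P q x :
  reflect (exists l a, [/\ odd l, max_ap3 q a l & x = a + 3 * l.-1])
    (largest_of_odd_ap3 q x).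
Proof.
apply: (iffP hasP) => [[l _ /andP[ol /hasP[a _ /andP[ml /eqP ->]]]]|].
  by exists l, a.
case=> l [a [ol ml xE]]; exists l.
  by rewrite mem_iota; have := max_ap3_size ml; case: l ol {ml xE}; lia.
rewrite ol; apply/hasP; exists a; last by rewrite ml xE /=.
case/max_ap3P: ml => l0 + _ _; apply.
by apply/mem_ap; exists 0; rewrite // muln0 addn0.
Qed.

(* Parts of a block pair up as (x, x + 3) with x odd. *)
Lemma in_upper_pair_partner q x : x \in q ->
  (if odd x then x + 3 \in q else (3 <= x) && (x - 3 \in q)) ->
  in_upper_pair q x.
Proof.
move=> xq hx; apply/and3P; split.
- apply/hasP; case: (odd x) hx => [|/andP[x3]] hx.
    by exists (x + 3) => //; rewrite eqxx.
  by exists (x - 3) => //; apply/orP; right; apply/eqP; lia.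
- apply/negP => /andP[ox /largest_of_odd_ap3P[l [a [ol /max_ap3P[l0 _ + _] xE]]]].
  by have -> : a + 3 * l = x + 3 by [lia]; rewrite ox in hx; rewrite hx.
- apply/negP => /andP[ox /smallest_of_odd_ap3P[l ol /max_ap3P[_ _ _ h]]].
  rewrite (negPf ox) in hx; case/andP: hx => x3 /h; lia.
Qed.

Lemma largest_not_pair q x : odd x -> largest_of_odd_ap3 q x ->
  in_upper_pair q x = false.
Proof. by move=> ox lx; rewrite /in_upper_pair ox lx andbF. Qed.

Lemma smallest_not_pair q x : ~~ odd x -> smallest_of_odd_ap3 q x ->
  in_upper_pair q x = false.
Proof. by move=> ox sx; rewrite /in_upper_pair ox sx !andbF. Qed.

(* What the parts of [q] preceding a singleton with base value [t] must satisfy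
   for it to end an odd progression downwards (if it is odd, [0 < a]) or to
   start one upwards (if it is [t + 1]). *)
Definition chain_before (q : seq nat) (t a : nat) : Prop :=
  if 0 < a then
    exists l c, [/\ odd l, {subset ap 3 c l <= q},
                  forall y, y \in q -> y + 3 != c & t = c + 3 * l.-1]
  else forall y, y \in q -> y + 3 != t + 1.

Lemma chain_not_pair q t a : odd t -> chain_before q t a.+1 -> t + 3 \notin q ->
  in_upper_pair q t = false.
Proof.
move=> ot [l [c [ol sc hc tE]]] tq; apply: largest_not_pair => //.
apply/largest_of_odd_ap3P; exists l, c; split=> //.
apply/max_ap3P; split=> //; first by case: l ol {sc tE}.
by have -> : c + 3 * l = t + 3 by case: l ol {sc} tE => //=; lia.
Qed.

(** The set [q] of all parts stays fixed in the induction; it is described only from [t] on, and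
    [chain_before] supplies what matters below. A block of even length [b] with the odd singleton
    extending it upwards, or the even one extending it downwards, is a maximal progression of odd
    length [b + 1], so that singleton is in no pair. *)
Lemma map_in_upper_pair q t a bs :
  odd t -> all (fun b => ~~ odd b) bs -> chain_before q t a ->
  (forall y, t <= y -> (y \in q) = (y \in segment t a bs)) ->
  map (in_upper_pair q) (segment t a bs) = pair_word bs.
Proof.
elim: bs t a => [|b bs IH] t a ot.
  move=> _ hc hq; congr cons.
  case: a hc hq => [|a] hc hq.
    apply: smallest_not_pair; first by rewrite oddD ot.
    apply/smallest_of_odd_ap3P; exists 1 => //.
    apply/max_ap3P; split=> //.
      move=> y /mem_ap[i i1 ->]; rewrite hq; last lia.
      by rewrite inE; apply/eqP => /=; lia.
    by rewrite hq ?inE /=; lia.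
  rewrite addn0; apply: chain_not_pair hc _ => //.
  by rewrite hq; [apply: segment_notin; lia | lia].
move=> /= /andP[ob obs] hc hq.
have hq' y : t <= y -> (y \in q) = (y \in segment t a (b :: bs)) by apply: hq.
have blockq i : i < b -> t + 4 + 3 * i \in q.
  move=> ib; rewrite hq' ?mem_segment_cons; last lia.
  by apply/or3P/Or32/mem_ap; exists i.
congr cons.
  case: a hc hq hq' => [|a] hc hq hq'.
    apply: smallest_not_pair; first by rewrite oddD ot.
    apply/smallest_of_odd_ap3P; exists b.+1 => //.
    apply/max_ap3P; split=> //.
      move=> y /mem_ap[[|i] ib ->].
        by rewrite hq'; [rewrite mem_segment_cons; apply/or3P/Or31/eqP=> /=; lia|lia].
      by rewrite (_ : _ + _ = t + 4 + 3 * i) ?blockq //; lia.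
    rewrite hq' ?mem_segment_cons; last lia.
    apply/negP => /or3P[/eqP /=|/mem_ap[i]|]; try lia.
    by apply/negP/segment_notin => /=; lia.
  rewrite addn0; apply: chain_not_pair hc _ => //.
  by rewrite hq'; [apply: segment_notin; lia | lia].
rewrite map_cat; congr cat.
  apply: (@eq_from_nth _ false) => [|i]; rewrite size_map size_ap ?size_nseq //.
  move=> ib; rewrite (nth_map 0) ?size_ap // nth_nseq ib nth_mkseq //.
  (* As [t] is odd, the part of index [i] is odd exactly when [i] is even; its partner has index
     [i + 1] then and [i - 1] otherwise. *)
  apply: in_upper_pair_partner; first exact: blockq.
  case: ifP => oi.
    by rewrite -addnA -mulnSr; apply: blockq; lia.
  rewrite (_ : 3 <= _) /=; last lia.
  by rewrite (_ : _ - _ = t + 4 + 3 * i.-1) ?blockq //; lia.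
(* If [1 < a], the next singleton is odd and ends the progression of the block just passed;
   otherwise it is even and no part lies 3 below it. *)
have [a1|a1] := ltnP 1 a.
  apply: IH => //; first lia.
    rewrite /chain_before (_ : 0 < a.-1); last lia.
    exists b.+1, (t + 4); split=> //=; try lia.
      move=> y /mem_ap[i ib ->]; have [/blockq //|bi] := ltnP i b.
      have -> : i = b by lia.
      rewrite hq' ?mem_segment_cons; last lia.
      apply/or3P/Or33; have := mem_segment_head (t + 4 + 3 * b) a.-1 bs.
      by rewrite (_ : (a.-1 == 0) = false) ?addn0 //; lia.
    move=> y yq; apply/eqP => yE; move: yq; rewrite hq'; last lia.
    by apply/negP/segment_notin; lia.
  move=> y ty; rewrite hq' ?mem_segment_cons; last lia.
  have -> : (y == t + (a == 0)) = false by lia.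
  by rewrite orFb orb_idl // => /mem_ap[i]; lia.
have -> : a.-1 = 0 by lia.
apply: IH => //; first lia.
  move=> y yq; apply/eqP => yE; move: yq; rewrite hq'; last lia.
  rewrite mem_segment_cons => /or3P[/eqP|/mem_ap[i]|/segment_ge]; lia.
move=> y ty; rewrite hq' ?mem_segment_cons; last lia.
have -> : (y == t + (a == 0)) = false by lia.
have -> : a.-1 = 0 by lia.
by rewrite orFb orb_idl // => /mem_ap[i]; lia.
Qed.

Lemma pair_word_segment s a bs : valid s a bs ->
  map (in_upper_pair (segment s a bs)) (segment s a bs) = pair_word bs.
Proof.
case/and5P=> os _ /andP[a0 _] obs _; apply: map_in_upper_pair => //.
rewrite /chain_before a0; exists 1, s; split=> //=; last lia.
  move=> y /mem_ap[i i0 ->]; have := mem_segment_head s a bs.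
  by case: i i0 => //; case: a a0 => // a _ _; rewrite muln0.
by move=> y /segment_ge; lia.
Qed.

(** * Subtracting 3 from every part *)

Lemma mem_shift3 u y : all (fun x => 3 < x) u -> (y \in shift3 u) = (y + 3 \in u).
Proof.
move=> /allP u3; apply/mapP/idP => [[x xu ->]|yu];
  last by exists (y + 3); rewrite ?addnK.
by rewrite subnK //; have := u3 x xu; lia.
Qed.

Lemma max_ap3_shift3 u a l : all (fun x => 3 < x) u ->
  max_ap3 (shift3 u) a l = max_ap3 u (a + 3) l.
Proof.
move=> u3; rewrite /max_ap3 !all_map mem_shift3 // has_map.
congr [&& _, _, _ & ~~ _].
- by apply: eq_all => i /=; rewrite mem_shift3 // addnAC.
- by rewrite addnAC.
- by apply: eq_in_has => y /(allP u3) /=; lia.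
Qed.

(** Subtracting 3 flips parities and so turns the two upper exceptions into the lower ones. Parts
    above 4 never become 1, so the filter in [in_lower_pair] keeps everything. *)
Lemma in_lower_pair_shift3 u y : all (fun x => 4 < x) u -> 1 < y ->
  in_lower_pair (shift3 u) y = in_upper_pair u (y + 3).
Proof.
move=> u4 y1; have u3 : all (fun x => 3 < x) u by apply: sub_all u4 => x; lia.
rewrite /in_lower_pair y1 /=.
have -> : [seq z <- shift3 u | 1 < z] = shift3 u.
  by apply/all_filterP; rewrite all_map; apply: sub_all u4 => x /=; lia.
have oy : odd (y + 3) = ~~ odd y by lia.
rewrite /in_upper_pair oy negbK; congr [&& _, ~~ (_ && _) & ~~ (_ && _)].
- by rewrite /has_neighbor3 has_map; apply: eq_in_has => x /(allP u4) /=; lia.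
- rewrite /largest_of_odd_ap3 size_map; apply: eq_has => l /=.
  rewrite has_map; congr (_ && _); apply: eq_in_has => x /(allP u4) /= x4.
  by rewrite max_ap3_shift3 // subnK; [congr (_ && _); lia | lia].
- rewrite /smallest_of_odd_ap3 size_map; apply: eq_has => l /=.
  by rewrite max_ap3_shift3.
Qed.

Lemma map_in_lower_pair_shift3 u : all (fun x => 4 < x) u ->
  map (in_lower_pair (shift3 u)) (shift3 u) = map (in_upper_pair u) u.
Proof.
move=> u4; rewrite -map_comp; apply/eq_in_map => x /(allP u4) /= x4.
by rewrite in_lower_pair_shift3 // ?subnK //; lia.
Qed.

(** * Statistics of a segment and recovery of its parameters *)

Lemma codewordE in_pair t :
  codeword in_pair t =
  [seq if b then LetterP else LetterS | b <- map (in_pair t) t].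
Proof. by rewrite -map_comp. Qed.

Lemma nb_pair_mod3E in_pair r t :
  nb_pair_mod3 in_pair r t =
  count (fun x => x %% 3 == r) (mask (map (in_pair t) t) t).
Proof.
by rewrite -filter_mask count_filter; apply: eq_count => x /=; rewrite andbC.
Qed.

Lemma nb_odd_shift3 u : all (fun x => 3 < x) u -> nb_odd (shift3 u) = nb_even u.
Proof.
by move=> u3; rewrite /nb_odd count_map; apply: eq_in_count => x /(allP u3) /=; lia.
Qed.

Lemma sumn_shift3 u : all (fun x => 3 < x) u ->
  sumn (shift3 u) + 3 * size u = sumn u.
Proof. by elim: u => //= x u IH /andP[x3 /IH]; lia. Qed.

Lemma shift3_inj u v : all (fun x => 3 < x) u -> all (fun x => 3 < x) v ->
  shift3 u = shift3 v -> u = v.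
Proof.
elim: u v => [|x u IH] [|y v] //= /andP[x3 u3] /andP[y3 v3] [xy /IH -> //].
by congr cons; lia.
Qed.

Lemma segment_gt4 s a bs : valid s a bs -> all (fun x => 4 < x) (segment s a bs).
Proof. by case/and3P=> os s3 _; apply/allP => x /segment_ge; lia. Qed.

Lemma segment_gt3 s a bs : valid s a bs -> all (fun x => 3 < x) (segment s a bs).
Proof. by move/segment_gt4; apply: sub_all => x; lia. Qed.

Lemma valid_swap s a bs : valid s a bs -> valid s ((size bs).+1 - a) bs.
Proof. by case/and5P=> os s3 ha ob m; apply/and5P; split=> //; lia. Qed.

Lemma head_segment t a bs : head 0 (segment t a bs) = t + (a == 0).
Proof. by case: bs. Qed.

Lemma size_segment t a bs : size (segment t a bs) = (size bs).+1 + sumn bs.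
Proof.
by elim: bs t a => //= b bs IH t a; rewrite size_cat IH size_ap; lia.
Qed.

(** Changing [a] moves singletons only, and the mask keeps only block parts. *)
Lemma mask_pair_word t a a' bs :
  mask (pair_word bs) (segment t a bs) = mask (pair_word bs) (segment t a' bs).
Proof.
elim: bs t a a' => //= b bs IH t a a'.
by rewrite !mask_cat ?size_nseq ?size_ap // (IH _ _ a'.-1).
Qed.

Lemma sumn_segment t a a' bs : a <= (size bs).+1 -> a' <= (size bs).+1 ->
  sumn (segment t a bs) + a = sumn (segment t a' bs) + a'.
Proof.
elim: bs t a a' => [|b bs IH] t a a' /= ha ha'; first lia.
rewrite !sumn_cat; have := IH (t + 4 + 3 * b) a.-1 a'.-1; lia.
Qed.

Lemma nb_odd_ap3 c l : nb_odd (ap 3 c l) = (l + odd c)./2.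
Proof. by elim: l c => [|l IH] c; rewrite ?ap_cons /= ?IH; lia. Qed.

(** A block of even length is half odd and half even; doubling avoids halving [sumn bs]. *)
Lemma nb_odd_segment t a bs :
  odd t -> all (fun b => ~~ odd b) bs -> a <= (size bs).+1 ->
  nb_odd (segment t a bs) * 2 = a * 2 + sumn bs.
Proof.
elim: bs t a => [|b bs IH] t a ot /=; first by rewrite /nb_odd /=; lia.
case/andP=> ob obs ha; have := IH (t + 4 + 3 * b) a.-1.
have := nb_odd_ap3 (t + 4) b.
by rewrite /nb_odd /= count_cat => ->; lia.
Qed.

Lemma nb_odd_even t : nb_odd t + nb_even t = size t.
Proof. exact: count_predC. Qed.

Lemma pair_word_inj : injective pair_word.
Proof.
have index_word b bs : index false (nseq b true ++ pair_word bs) = b.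
  rewrite index_cat size_nseq; case: (bs) => [|? ?];
  by rewrite mem_nseq /= andbF addn0.
elim=> [|b bs IH] [|b' bs'] //= [].
- by case: b' => [|b']; case: bs'.
- by case: b => [|b]; case: bs {IH}.
move=> E; have Eb : b = b' by rewrite -(index_word b bs) E index_word.
by move/eqP: E; rewrite Eb eqseq_cat // eqxx => /eqP/IH ->.
Qed.

(** The pairing pattern gives [bs], the smallest part gives [s] because the first singleton is odd,
    and the number of odd parts then gives [a]. *)
Lemma segment_inj s a bs s' a' bs' : valid s a bs -> valid s' a' bs' ->
  segment s a bs = segment s' a' bs' -> [/\ s = s', a = a' & bs = bs'].
Proof.
move=> v v' E; have := pair_word_segment v; rewrite E pair_word_segment //.
move/pair_word_inj => Ebs; subst bs'.
case/and5P: v => os _ ha obs _; case/and5P: v' => os' _ ha' _ _.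
have := congr1 (head 0) E; rewrite !head_segment => Es.
have := congr1 nb_odd E => En.
have := @nb_odd_segment s a bs; have := @nb_odd_segment s' a' bs.
by split=> //; lia.
Qed.

(** * Statistics under the exchange of [a] and N - [a] *)

Section Swap.
Variables (s a : nat) (bs : seq nat).
Hypothesis v : valid s a bs.
Let u := segment s a bs.
Let u' := segment s ((size bs).+1 - a) bs.
Let v' := valid_swap v.

Lemma map_pair_swap :
  map (in_lower_pair (shift3 u')) (shift3 u') = map (in_upper_pair u) u.
Proof. by rewrite map_in_lower_pair_shift3 ?segment_gt4 // !pair_word_segment. Qed.

Lemma codeword_swap :
  codeword in_lower_pair (shift3 u') = codeword in_upper_pair u.
Proof. by rewrite !codewordE map_pair_swap. Qed.

Lemma nb_pair_mod3_swap r :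
  nb_pair_mod3 in_lower_pair r (shift3 u') = nb_pair_mod3 in_upper_pair r u.
Proof.
rewrite !nb_pair_mod3E map_pair_swap pair_word_segment // /u.
rewrite -[in LHS]map_mask (mask_pair_word _ _ ((size bs).+1 - a)) -/u' count_map.
apply: eq_in_count => x /mem_mask /(allP (segment_gt3 v')) /=; lia.
Qed.

Lemma nb_odd_swap : nb_odd (shift3 u') = nb_odd u.
Proof.
rewrite nb_odd_shift3 ?segment_gt3 //; case/and5P: v => os _ ha obs _.
have := nb_odd_even u'; rewrite size_segment.
have := @nb_odd_segment s a bs; have := @nb_odd_segment s ((size bs).+1 - a) bs.
rewrite -/u -/u'; lia.
Qed.

Lemma nb_even_swap : nb_even (shift3 u') = nb_even u.
Proof.
have := nb_odd_even u; have := nb_odd_even (shift3 u').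
by rewrite nb_odd_swap size_map !size_segment; lia.
Qed.

(** With N singletons and B the sum of [bs], passing to [u'] adds 2a - N to the sum, and the shift
    removes 3N + 3B. The loss 4N - 2a + 3B is twice the number a + B/2 of odd parts of [u] plus four
    times the number N - a + B/2 of even ones. *)
Lemma sumn_swap :
  sumn (shift3 u') + 2 * (nb_odd u + 2 * nb_even u) = sumn u.
Proof.
have := sumn_shift3 (segment_gt3 v'); have := nb_odd_even u.
case/and5P: v => os _ ha obs _; have := @nb_odd_segment s a bs.
have := @sumn_segment s a ((size bs).+1 - a) bs.
rewrite !size_segment -/u -/u'; lia.
Qed.

Lemma head_swap : head 0 (shift3 u') + 3 = head 0 u.
Proof.
case/and5P: v => os s3 ha _ _; rewrite /u head_segment /u'.
have := head_segment s ((size bs).+1 - a) bs.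
by case: (segment _ _ bs) => /=; lia.
Qed.

End Swap.

(** * Segments and the construction rules *)

Lemma segment_cat t a bs b bs' :
  segment t a (bs ++ b :: bs') =
  segment t a bs ++ ap 3 (t + 4 * size bs + 3 * sumn bs + 4) b ++
  segment (t + 4 * size bs + 3 * sumn bs + 4 + 3 * b) (a - (size bs).+1) bs'.
Proof.
elim: bs t a => [|c bs IH] t a; first by rewrite /= subn1 !muln0 !addn0.
rewrite /= IH -!catA; congr (_ :: _ ++ _ ++ ap _ _ _ ++ segment _ _ _); lia.
Qed.

Lemma segment_nseq_odd t a k : k < a -> segment t a (nseq k 0) = ap 4 t k.+1.
Proof.
elim: k t a => [|k IH] t a ka; rewrite ap_cons /=; first by congr cons; lia.
by rewrite IH; [congr (_ :: ap _ _ _); lia | lia].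
Qed.

Lemma segment_nseq_even t k : segment t 0 (nseq k 0) = ap 4 (t + 1) k.+1.
Proof.
by elim: k t => [|k IH] t; rewrite ap_cons //= IH; congr (_ :: ap _ _ _); lia.
Qed.

Lemma last_segment t a bs :
  last 0 (segment t a bs) = t + 4 * size bs + 3 * sumn bs + (a <= size bs).
Proof.
suff H x : last x (segment t a bs) =
  t + 4 * size bs + 3 * sumn bs + (a <= size bs) by [].
elim: bs t a x => [|b bs IH] t a x /=; first lia.
by rewrite last_cat IH; lia.
Qed.

Lemma blocks_mod3_cat t bs bs' :
  blocks_mod3 t (bs ++ bs') =
  blocks_mod3 t bs && blocks_mod3 (t + 4 * size bs + 3 * sumn bs) bs'.
Proof.
elim: bs t => [|b bs IH] t /=; first by rewrite !muln0 !addn0.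
by rewrite IH -andbA; congr [&& _, _ & blocks_mod3 _ _]; lia.
Qed.

Lemma blocks_mod3_nseq t k : blocks_mod3 t (nseq k 0).
Proof. by elim: k t => //=. Qed.

Lemma all_even_nseq k : all (fun b => ~~ odd b) (nseq k 0).
Proof. by rewrite all_nseq orbT. Qed.

Lemma sumn_nseq0 k : sumn (nseq k 0) = 0.
Proof. by rewrite sumn_nseq mul0n. Qed.

(** Covers both primitive forms: [p = 0] is the first, with its gap of 5 between odd and even
    singletons. *)
Lemma primitive_segment o x p y :
  segment o x.+1 (nseq x 0 ++ p :: nseq y 0) =
  ap 4 o x.+1 ++ ap 3 (o + 4 * x + 1 + 3) p ++
  ap 4 (o + 4 * x + 1 + 3 * p + 4) y.+1.
Proof.
rewrite segment_cat segment_nseq_odd // size_nseq sumn_nseq0 subnn.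
by rewrite segment_nseq_even; congr (_ ++ ap _ _ _ ++ ap _ _ _); lia.
Qed.

(** The bound on [a] makes the last singleton a raised one. The [y] empty blocks separate [y.+1] new
    singletons. *)
Lemma suffix_segment t a bs p y : a <= size bs ->
  segment t a (bs ++ p :: nseq y 0) =
  segment t a bs ++ suffix_parts (last 0 (segment t a bs)) p y.+1.
Proof.
move=> ha; rewrite last_segment ha segment_cat (_ : a - _ = 0); last lia.
by rewrite segment_nseq_even; congr (_ ++ ap _ _ _ ++ ap _ _ _); lia.
Qed.

Lemma prefix_segment o a k p bs :
  segment o (a + k.+1) (nseq k 0 ++ p :: bs) =
  prefix_parts o k p ++ segment (o + 4 * k + 4 + 3 * p) a bs.
Proof.
rewrite segment_cat segment_nseq_odd ?size_nseq ?sumn_nseq0; last lia.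
rewrite addnK /prefix_parts -catA.
by congr (_ ++ ap _ _ _ ++ segment _ _ _); lia.
Qed.

(** Each rule adds one block [p] and a run of singletons 4 apart, hence separated by empty blocks:
    even ones after [p] for a suffix, odd ones before [p] for a prefix. *)
Lemma upper_minimal_valid u : upper_minimal u ->
  exists s a bs, valid s a bs /\ u = segment s a bs.
Proof.
elim=> {u} [t [o x y oo o3 -> _|o x p y oo o3 m y1 p2 op -> _]|
  t p y _ [s [a [bs [v ->]]]] _ m p2 op y1|
  t o k p _ [s [a [bs [v ->]]]] ho m oo o3 p2 op].
- exists o, x.+1, (nseq x 0 ++ 0 :: nseq y 0); split.
    rewrite /valid oo o3 size_cat /= !size_nseq all_cat /= !all_even_nseq.
    by rewrite blocks_mod3_cat /= !blocks_mod3_nseq; lia.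
  by rewrite primitive_segment /primitive_form1; congr (_ ++ ap _ _ _); lia.
- exists o, x.+1, (nseq x 0 ++ p :: nseq y.-1 0); split.
    rewrite /valid oo o3 size_cat /= !size_nseq all_cat /= !all_even_nseq op.
    rewrite blocks_mod3_cat /= !blocks_mod3_nseq size_nseq sumn_nseq0; lia.
  by rewrite primitive_segment /primitive_form2 prednK.
- case/and5P: v => os s3 ha obs mbs.
  exists s, a, (bs ++ p :: nseq y.-1 0); split.
    rewrite /valid os s3 size_cat /= !size_nseq all_cat /= obs all_even_nseq op.
    rewrite blocks_mod3_cat /= mbs blocks_mod3_nseq.
    by move: m; rewrite last_segment; lia.
  by rewrite suffix_segment ?prednK //; lia.
- case/and5P: v => os s3 ha obs mbs.
  have {ho m} [ho m] : s = o + 4 * k + 4 + 3 * p /\ ~~ (3 %| s).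
    by move: ho m; rewrite /head; case: (bs) => [|b bs'] /=; lia.
  exists o, (a + k.+1), (nseq k 0 ++ p :: bs); split.
    rewrite /valid oo o3 size_cat /= !size_nseq all_cat /= obs all_even_nseq op.
    rewrite blocks_mod3_cat /= blocks_mod3_nseq size_nseq sumn_nseq0 muln0 addn0.
    rewrite (_ : o + 4 * k + 4 + 3 * p = s) // mbs; lia.
  by rewrite prefix_segment -ho.
Qed.

Lemma upper_minimal_primitive o x p y :
  odd o -> 3 < o -> ~~ odd p -> (p == 0) || ~~ (3 %| o + 4 * x + 1) ->
  upper_minimal (segment o x.+1 (nseq x 0 ++ p :: nseq y 0)).
Proof.
move=> oo o3 op hp; apply: UpperPrimitive.
have H : schur (segment o x.+1 (nseq x 0 ++ p :: nseq y 0)).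
  apply/andP; split; first by apply/allP => z /segment_ge; lia.
  rewrite primitive_segment ap_cons /= schur_path_ap4.
  case: p op hp => [|p] op hp.
    rewrite ap_cons /= -[ap 4 _ _]cats0.
    rewrite (_ : o + 4 * x + 1 + 3 * 0 + 4 = o + 4 * x + 5); last lia.
    by rewrite schur_path_ap4 /= /schur_gap; lia.
  rewrite ap_cons /= schur_path_ap3; last lia.
  rewrite (_ : _ + 3 * p = o + 4 * x + 1 + 3 * p.+1); last lia.
  by rewrite -[ap 4 _ _]cats0 schur_path_ap4 /= /schur_gap; lia.
case: p op hp H => [|p] op hp H.
  apply: (@Primitive1 _ o x y) => //; rewrite primitive_segment.
  by congr (_ ++ ap _ _ _); lia.
by apply: (@Primitive2 _ o x p.+1 y.+1) => //; try lia; rewrite primitive_segment.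
Qed.

Lemma first_nonzero (bs : seq nat) :
  (exists k, bs = nseq k 0) \/
  exists k b bs', b != 0 /\ bs = nseq k 0 ++ b :: bs'.
Proof.
elim: bs => [|[|b] bs [[k ->]|[k [b' [bs' [b0 ->]]]]]]; first by left; exists 0.
- by left; exists k.+1.
- by right; exists k.+1, b', bs'.
- by right; exists 0, b.+1, (nseq k 0).
- by right; exists 0, b.+1, (nseq k 0 ++ b' :: bs').
Qed.

Lemma last_nonzero (bs : seq nat) :
  (exists k, bs = nseq k 0) \/
  exists bs' b k, b != 0 /\ bs = bs' ++ b :: nseq k 0.
Proof.
case: (first_nonzero (rev bs)) => [[k E]|[k [b [bs' [b0 E]]]]].
  by left; exists k; rewrite -[bs]revK E rev_nseq.
right; exists (rev bs'), b, k; split=> //.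
by rewrite -[bs]revK E rev_cat rev_nseq rev_cons cat_rcons.
Qed.

(** The first [x] blocks, those between odd singletons, are empty. The suffix rule accounts for the
    last nonempty block among even singletons and for all that follows it; removing these repeatedly
    leaves a primitive segment. *)
Lemma upper_minimal_no_prefix s x bs :
  valid s x.+1 (nseq x 0 ++ bs) -> upper_minimal (segment s x.+1 (nseq x 0 ++ bs)).
Proof.
have [n] := ubnP (size bs); elim: n bs => // n IH [|b bs] /= szb v.
  by case/and5P: v; rewrite cats0 size_nseq; lia.
(* Block [b] separates the last odd singleton from the first even one and belongs to the primitive
   core, so only the blocks after it are searched. *)
case: (last_nonzero bs) => [[k Ek]|[bs' [p [k [p0 E]]]]].
  case/and5P: v; rewrite all_cat blocks_mod3_cat /= size_nseq sumn_nseq0 Ek.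
  move=> os s3 _ /and3P[_ ob _] /and3P[_ mb _].
  by apply: upper_minimal_primitive => //; lia.
have sz := congr1 size E; rewrite size_cat /= in sz.
rewrite E -[b :: _ ++ _]cat_cons catA.
have := v; rewrite E -cat_cons catA => /and5P[os s3 _].
rewrite all_cat blocks_mod3_cat => /andP[ob /=/andP[op _]] /andP[mb /=/andP[mp _]].
have ha : x < size (nseq x 0 ++ b :: bs') by rewrite size_cat size_nseq /=; lia.
rewrite suffix_segment //; apply: UpperSuffix => //; rewrite ?last_segment ?ha.
- by apply: IH; [rewrite /=; lia | apply/and5P; split].
- have : ~~ odd (sumn (nseq x 0 ++ b :: bs')); last by lia.
  by elim: (_ ++ _) ob => //= c cs IHc /andP[oc /IHc]; lia.
- lia.
- by case: p p0 op {E mp} => [|[|]].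
Qed.

(** Prefixes are peeled off as long as the first nonempty block lies between two odd singletons. *)
Lemma valid_upper_minimal s a bs : valid s a bs -> upper_minimal (segment s a bs).
Proof.
have [n] := ubnP (size bs); elim: n s a bs => // n IH s a bs szb v.
have [os s3 ha obs mbs] := and5P v.
case: (first_nonzero bs) => [[k E]|[k [p [bs' [p0 E]]]]].
  have E' : bs = nseq a.-1 0 ++ nseq (k - a.-1) 0.
    by move: ha; rewrite E size_nseq -nseqD => ha; congr nseq; lia.
  case: a ha E' {IH} v => // a _ -> v.
  exact: upper_minimal_no_prefix.
(* Counting from 1, block [p] precedes singleton [k + 2], which is odd exactly when [k + 1 < a]. *)
have [ka|ak] := ltnP k.+1 a; last first.
  have E' : bs = nseq a.-1 0 ++ (nseq (k - a.-1) 0 ++ p :: bs').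
    by rewrite catA -nseqD subnKC //; lia.
  case: a ha ak E' {IH} v => // a _ _ -> v.
  exact: upper_minimal_no_prefix.
move: obs mbs ha szb; rewrite E size_cat all_cat blocks_mod3_cat /= size_nseq.
rewrite sumn_nseq0 muln0 addn0 => /and3P[_ op obs] /and3P[_ mp mbs] ha szb.
rewrite -(@subnK k.+1 a) // ?prefix_segment; last lia.
have hh : head 0 (segment (s + 4 * k + 4 + 3 * p) (a - k.+1) bs') =
    s + 4 * k + 4 + 3 * p by case: (bs') => [|? ?] /=; lia.
apply: UpperPrefix => //; rewrite ?hh; try lia.
apply: IH; first lia.
by rewrite /valid obs mbs; lia.
Qed.

(** The exchange is an involution on the range of [a], so the form used by the bijection reaches
    every valid segment. Both ends are lower singletons because [pair_word] starts and ends with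
    [false]. *)
Lemma lower_minimalP t :
  lower_minimal t <->
  exists s a bs, valid s a bs /\ t = shift3 (segment s ((size bs).+1 - a) bs).
Proof.
split=> [[u /upper_minimal_valid[s [a [bs [v ->]]]] [-> _ _]]|[s [a [bs [v ->]]]]].
  exists s, ((size bs).+1 - a), bs; rewrite valid_swap // subKn //.
  by case/and5P: v; lia.
have v' := valid_swap v; set u := segment _ _ _.
have u4 : all (fun x => 4 < x) u := segment_gt4 v'.
exists u; first exact: valid_upper_minimal.
have /(congr1 (nth false)) Enth := pair_word_segment v'; rewrite -/u in Enth.
have un : u != [::] by rewrite -size_eq0 size_segment.
have pair_end x : x \in u -> ~~ in_upper_pair u x ->
    ~~ in_lower_pair (shift3 u) (x - 3).
  by move=> /(allP u4) /= x4; rewrite in_lower_pair_shift3 ?subnK //; lia.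
have hd : head 0 (shift3 u) = head 0 u - 3 by case: (u) un.
have ls : last 0 (shift3 u) = last 0 u - 3.
  by case: (u) un => //= x r _; exact: (last_map (subn^~ 3)).
split; rewrite // ?hd ?ls; apply: pair_end.
- by case: (u) un => //= x r _; rewrite inE eqxx.
- have := congr1 (fun f => f 0) Enth; rewrite (nth_map 0) ?lt0n ?size_eq0 //.
  by rewrite nth0 => ->; case: (bs).
- by case: (u) un => //= x r _; apply: mem_last.
rewrite -nth_last; have := congr1 (fun f => f (size u).-1) Enth.
rewrite (nth_map 0) ?prednK ?lt0n ?size_eq0 // => ->.
rewrite -(size_map (in_upper_pair u)) pair_word_segment // nth_last.
by elim: (bs) => //= b bs' IH; rewrite last_cat; case: bs' IH.
Qed.

(** * The bijection *)

Unset Implicit Arguments.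

Theorem theorem2 (w e p1 p2 n : nat) :
  exists rho : seq nat -> seq nat,
    set_bij (upper_segments w e p1 p2 (Posz n))
            (lower_segments w e p1 p2 (Posz n - Posz (2 * (w + 2 * e)))%R) rho
    /\ (forall (t : seq nat) (W : seq letter) (s : int),
          upper_segments w e p1 p2 (Posz n) t ->
          upper_quadruple t = (W, w, e, s) ->
          lower_quadruple (rho t) = (W, w, e, (s - 3)%R)).
Proof.
(* The image is obtained by choice, with [[::]] as default off the valid segments; [segment_inj]
   makes it unique. *)
pose rho t := xget [::] (fun t' => exists s a bs, [/\ valid s a bs,
  t = segment s a bs & t' = shift3 (segment s ((size bs).+1 - a) bs)]).
have rhoE s a bs : valid s a bs ->
    rho (segment s a bs) = shift3 (segment s ((size bs).+1 - a) bs).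
  move=> v; apply: xget_unique; first by exists s, a, bs.
  by move=> t' [s' [a' [bs' [v' E ->]]]]; case: (segment_inj v v' E) => -> -> ->.
have upper_inv t : upper_segments w e p1 p2 (Posz n) t ->
    exists s a bs, valid s a bs /\ t = segment s a bs.
  by case=> /upper_minimal_valid.
exists rho; split; [split|].
- move=> t ut; have [s [a [bs [v tE]]]] := upper_inv t ut.
  case: ut => _ [sn wE eE p1E p2E]; rewrite /= tE rhoE //; subst t.
  split; first by apply/lower_minimalP; exists s, a, bs.
  split; rewrite ?nb_odd_swap ?nb_even_swap ?nb_pair_mod3_swap //.
  by have := sumn_swap v; lia.
- move=> t t' /set_mem/upper_inv[s [a [bs [v ->]]]].
  move=> /set_mem/upper_inv[s' [a' [bs' [v' ->]]]].
  rewrite !rhoE // => /shift3_inj E.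
  have [|-> aE bsE] := segment_inj (valid_swap v) (valid_swap v').
    by apply: E; apply/segment_gt3/valid_swap.
  subst bs'; congr segment; case/and5P: v => _ _ ? _ _.
  by case/and5P: v' => _ _ ? _ _; lia.
(* Surjectivity: the preimage keeps [s] and [bs] and undoes the exchange. *)
- move=> t' [/lower_minimalP[s [a [bs [v ->]]]] [sn wE eE p1E p2E]].
  exists (segment s a bs); last exact: rhoE.
  split; first exact: valid_upper_minimal.
  rewrite -(nb_odd_swap v) -(nb_even_swap v) -!(nb_pair_mod3_swap v).
  split=> //; have := sumn_swap v.
  by rewrite -(nb_odd_swap v) -(nb_even_swap v); lia.
move=> t W s0 /upper_inv[s [a [bs [v ->]]]] [<- wE eE <-].
rewrite rhoE // /lower_quadruple /quadruple codeword_swap // nb_odd_swap //.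
rewrite nb_even_swap // wE eE; congr (_, _).
by have := head_swap v; lia.
Qed.
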